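(* Let $\lambda_1,\lambda_2,\dots$ be i.i.d. positive random variables, independent of the source-destination pairing, and for each perfect square $n\ge4$ let the demand rate vector of the $n$-node multi-hop mesh network be $\mathbf r=(r_1,\dots,r_n)=\eta_n(\lambda_1,\dots,\lambda_n)$. Let $T_1$ be the throughput of the network with uniform rate vector $\eta_n'(1,\dots,1)$ (i.e. $T_1=n\eta_n'$ with $\eta_n'$ the largest feasible value) and let $T_2=\sum_i r_i=\eta_n\sum_i\lambda_i$ with $\eta_n$ the largest feasible value for the non-uniform rate vector, both under the multi-hopping scheme. Then $$\mathbb{E}\{T_2\}=\Omega\left(\mathbb{E}\left\{\frac{T_1\sum_{i=1}^n r_i}{n\max_{1\le i\le n} r_i}\right\}\right)=\Omega\left(\mathbb{E}\left\{\frac{T_1\sum_{i=1}^n\lambda_i}{n\max_{1\le i\le n}\lambda_i}\right\}\right).$$ In particular, if the $\lambda_i$ have the heavy-tailed distribution $F_\lambda(x)=1-x^{-\alpha}$, $x\ge1$, with parameter $\alpha>0$, then $$\mathbb{E}\{T_2\}=\Omega\left(n^{1/2-1/\alpha}\right).$$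
   Context: Network: $n$ nodes (with $n$ a perfect square) placed on a $\sqrt n\times\sqrt n$ two-dimensional mesh; two nodes are neighbors (joined by a wireless link) iff their coordinates agree in one dimension and differ by exactly $1$ in the other. There are $n$ unicast sessions: each node is the source of exactly one session and the destination of exactly one session, the source and destination of a session being distinct; the pairing is chosen uniformly at random among all such pairings. Multi-hopping scheme: each session is routed by X-Y routing: its packets first travel along dimension X, by the shortest path, until they reach the X-coordinate of the destination, then along dimension Y, by the shortest path, to the destination. Medium access is 9-TDMA spatial reuse: the mesh is divided into $3\times3$ blocks whose nodes are labeled $1,\dots,9$ in the same way in every block, and in time slot $t$ only nodes whose label is congruent to $t$ modulo $9$ transmit, each sending at most one packet to one neighbor; these transmissions are all successful (path loss exponent $\gamma>2$). Hence each node forwards at most one packet per $9$ slots. Feasibility: a rate vector $\mathbf r=(r_1,\dots,r_n)$ (packets per slot) is feasible if for every node $v$ the sum of $r_i$ over all sessions $i$ for which $v$ is a transmitting node of the route (any node on the route other than the destination) is at most $1/9$. The throughput is $\sum_i r_i$. Expectations are over both the random pairing and the $\lambda_i$. $\eta_n$ and $\eta_n'$ may depend on $n$, on the pairing and (for $\eta_n$) on the $\lambda_i$. *)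

(* Defs.v *)
From mathcomp Require Export all_boot all_order all_algebra perm finmap.
From mathcomp Require Export all_classical all_reals all_analysis.
Export Order.TTheory GRing.Theory Num.Theory.
Export numFieldNormedType.Exports.
From mathcomp Require Import zify ring lra.

Set Implicit Arguments.
Unset Strict Implicit.
Unset Printing Implicit Defensive.

Local Open Scope ring_scope.
Local Open Scope classical_set_scope.

Section Mesh.
Implicit Types a b s d v : nat * nat.
Local Open Scope nat_scope.

Definition mesh_link a b : bool :=
  ((a.1 == b.1) && (`|a.2 - b.2| == 1)) || ((a.2 == b.2) && (`|a.1 - b.1| == 1)).

Definition mesh_dist a b : nat := `|a.1 - b.1| + `|a.2 - b.2|.

(* The node to which [v] forwards a packet destined to [d]: the X coordinate
   is corrected first, and the Y coordinate only once it agrees with [d]. *)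
Definition xy_hop d v : nat * nat :=
  if v.1 < d.1 then (v.1.+1, v.2)
  else if d.1 < v.1 then (v.1.-1, v.2)
  else if v.2 < d.2 then (v.1, v.2.+1)
  else if d.2 < v.2 then (v.1, v.2.-1)
  else v.

Definition xy_route s d : seq (nat * nat) :=
  traject (xy_hop d) s (mesh_dist s d).+1.

Definition transmits v s d : bool := (v \in xy_route s d) && (v != d).

Lemma xy_routeP s d :
  path mesh_link s (behead (xy_route s d)) /\ last s (xy_route s d) = d.
Proof.
suff H m : forall s, mesh_dist s d = m ->
    let p := traject (xy_hop d) (xy_hop d s) m in
    path mesh_link s p /\ last s p = d by exact: H.
elim: m => [|m IH] {}s sd /=.
  split=> //; move: sd; case: s => s1 s2; case: d => d1 d2.
  by rewrite /mesh_dist /= => sd; congr pair; lia.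
have hop : mesh_link s (xy_hop d s) /\ mesh_dist (xy_hop d s) d = m.
  clear IH; move: sd; case: s => s1 s2; case: d => d1 d2.
  rewrite /mesh_dist /mesh_link /xy_hop /=.
  by do !case: ifPn => ? /=; move=> ?; split; lia.
by have [-> /= lastE] := IH _ hop.2; rewrite hop.1.
Qed.

(* Node number [i] of the [k] by [k] mesh, in row-major order. *)
Definition coord k (i : 'I_(k ^ 2)) : nat * nat := (i %% k, i %/ k).

(* The session pairings of the [k ^ 2] nodes.  Sessions are numbered by their
   source, so that session [i] goes from node [i] to node [s i]. *)
Definition pairings k : {set {perm 'I_(k ^ 2)}} :=
  [set s : {perm 'I_(k ^ 2)} | [forall i, s i != i]]%SET.

End Mesh.

Section Throughput.
Context {R : realType}.
Variables (k : nat) (s : {perm 'I_(k ^ 2)}).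
Implicit Types r u : 'I_(k ^ 2) -> R.

Definition node_load r (v : 'I_(k ^ 2)) : R :=
  \sum_(i < k ^ 2 | transmits (coord v) (coord i) (coord (s i))) r i.

(* The bound 9^-1 is the forwarding rate of a node under 9-TDMA. *)
Definition feasible r : Prop := forall v, node_load r v <= 9^-1.

(* The supremum is a maximum in the cases of interest: see [max_scaleP]. *)
Definition max_scale u : R := sup [set eta : R | feasible (fun i => eta * u i)].

Definition rate u (i : 'I_(k ^ 2)) : R := max_scale u * u i.

Definition throughput u : R := \sum_(i < k ^ 2) rate u i.

Lemma transmits_source i : s i != i -> transmits (coord i) (coord i) (coord (s i)).
Proof.
move=> sii; rewrite /transmits /xy_route /= mem_head /=.
apply: contra sii => /eqP[ik idk]; apply/eqP/val_inj => /=.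
by rewrite (divn_eq (s i) k) -ik -idk -divn_eq.
Qed.

Lemma max_scaleP u : (0 < k)%N -> s \in pairings k -> (forall i, 0 < u i) ->
  feasible (rate u) /\
  forall eta, feasible (fun i => eta * u i) -> eta <= max_scale u.
Proof.
move=> k0; rewrite inE => /forallP sP u0.
have loadZ eta v : node_load (fun i => eta * u i) v = eta * node_load u v.
  by rewrite /node_load mulr_sumr.
have load_gt0 v : 0 < node_load u v.
  rewrite /node_load (bigD1 v) ?transmits_source//= ltr_pwDl//.
  by apply: sumr_ge0 => i _; exact: ltW.
have bnd eta v : feasible (fun i => eta * u i) -> eta <= 9^-1 / node_load u v.
  by move=> /(_ v); rewrite loadZ ler_pdivlMr.
have n0 : (0 < k ^ 2)%N by rewrite expn_gt0 k0.
have hs : has_sup [set eta : R | feasible (fun i => eta * u i)].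
  split; last by exists (9^-1 / node_load u (Ordinal n0)) => eta /bnd.
  by exists 0 => v; rewrite loadZ mul0r invr_ge0.
split=> [v|eta feta]; last exact: ub_le_sup hs.2 eta feta.
rewrite loadZ -ler_pdivlMr//.
by apply: ge_sup => [|eta /bnd]; [exact: hs.1|exact].
Qed.

End Throughput.

Section Randomness.
Context {R : realType} {d : measure_display} {Omega : measurableType d}.
Variable P : probability Omega R.
Local Open Scope ereal_scope.

Definition identically_distributed {I : Type} (X : I -> {RV P >-> R}) : Prop :=
  forall i j (A : set R), measurable A ->
    distribution P (X i) A = distribution P (X j) A.

Definition mutually_independent {I : choiceType} (X : I -> {RV P >-> R}) : Prop :=
  forall (J : {fset I}) (A : I -> set R), (forall i, measurable (A i)) ->
    P (\bigcap_(i in [set` J]) X i @^-1` A i) = \prod_(i <- J) P (X i @^-1` A i).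

Definition uniform_on {T : finType} (D : {set T}) (Y : Omega -> T) : Prop :=
  forall t : T, measurable (Y @^-1` [set t]) /\
    P (Y @^-1` [set t]) = if t \in D then (#|D|%:R^-1)%:E else 0.

Definition independent_of_family {I : Type} {T : finType}
    (Y : Omega -> T) (X : I -> {RV P >-> R}) : Prop :=
  forall (t : T) (E : set Omega),
    <<s \bigcup_i preimage_set_system setT (X i) measurable >> E ->
    P (Y @^-1` [set t] `&` E) = P (Y @^-1` [set t]) * P E.

End Randomness.

(* Main.v *)
(** Scaling the demand by its maximum only increases every node load, so the
    largest load [M u] of a demand vector [u] satisfies
    [M u <= max u * M 1].  As the largest feasible scaling factor of [u] is
    [1 / (9 M u)], this gives [T2 >= T1 * (sum u) / (n * max u)] for every
    pairing and every positive [u]; moreover [T2 <= n / 9], so that all the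
    expectations are finite.

    An X-Y route from [s] to [d] only visits nodes in the row of [s] or in the
    column of [d], hence [M 1 <= 2 sqrt n] and [T1 >= sqrt n / 18] for every
    pairing.  If the rates are Pareto distributed, then they are at least [1],
    and a union bound shows that all of them are at most [(2n)^(1/alpha)] with
    probability at least [1/2]; on that event
    [T2 >= sqrt n / 18 * (2n)^(-1/alpha)]. *)
Require Import Defs.
From mathcomp Require Import zify ring lra measurable_realfun.

Set Implicit Arguments.
Unset Strict Implicit.
Unset Printing Implicit Defensive.

Local Open Scope ring_scope.
Local Open Scope classical_set_scope.

(** * Counting the sessions that a node forwards *)

Section Load.
Local Open Scope nat_scope.
Implicit Types s d v : nat * nat.

(** Induction on the number of hops: Y moves only after X has reached that of [d], and X stays fixed
    from then on. *)
Lemma xy_route_row_or_col s d v : v \in xy_route s d -> v.2 = s.2 \/ v.1 = d.1.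
Proof.
case/trajectP => m _ ->; elim: m => [|m IH]; first by left.
rewrite iterS; set w := iter _ _ _ in IH *.
by move: IH; rewrite /xy_hop; do !case: ifPn => ? /=; lia.
Qed.

Lemma card_coord1 k (c : nat) : #|[set i : 'I_(k ^ 2) | (coord i).1 == c]%SET| <= k.
Proof.
rewrite -[X in _ <= X]card_ord.
have lt_div (i : 'I_(k ^ 2)) : i %/ k < k.
  case: k i => [|k] i; first by case: i.
  by rewrite ltn_divLR // -expnSr.
rewrite -(@card_in_imset _ _ (fun i : 'I_(k ^ 2) => Ordinal (lt_div i))).
  exact: max_card.
move=> i j; rewrite !inE => /eqP ic /eqP jc [] ij; apply/val_inj => /=.
by rewrite (divn_eq i k) (divn_eq j k) ij; congr addn; rewrite [LHS]ic.
Qed.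

Lemma card_coord2 k (c : nat) : #|[set i : 'I_(k ^ 2) | (coord i).2 == c]%SET| <= k.
Proof.
rewrite -[X in _ <= X]card_ord.
have lt_mod (i : 'I_(k ^ 2)) : i %% k < k.
  by case: k i => [|k] i; [case: i|rewrite ltn_pmod].
rewrite -(@card_in_imset _ _ (fun i : 'I_(k ^ 2) => Ordinal (lt_mod i))).
  exact: max_card.
move=> i j; rewrite !inE => /eqP ic /eqP jc [] ij; apply/val_inj => /=.
by rewrite (divn_eq i k) (divn_eq j k) ij; congr addn; rewrite -jc in ic; congr muln.
Qed.

(** A session transmitted by [v] has its source in the row of [v] or its destination in the column
    of [v]. As [s] is injective, each case accounts for at most [k] sessions. *)
Lemma card_transmits k (s : {perm 'I_(k ^ 2)}) (v : 'I_(k ^ 2)) :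
  #|[set i | transmits (coord v) (coord i) (coord (s i))]%SET| <= 2 * k.
Proof.
pose A := [set i : 'I_(k ^ 2) | (coord i).2 == (coord v).2]%SET.
pose B := [set i : 'I_(k ^ 2) | (coord i).1 == (coord v).1]%SET.
apply: (@leq_trans #|(A :|: s @^-1: B)%SET|).
  apply/subset_leq_card/fintype.subsetP => i; rewrite !inE.
  by case/andP => /xy_route_row_or_col[] /= ->; rewrite eqxx ?orbT.
rewrite mul2n -addnn (leq_trans (leq_card_setU _ _)) // leq_add ?card_coord2 //.
by rewrite card_preimset ?card_coord1 //; exact: perm_inj.
Qed.

End Load.

(** * Scaling factors and throughput for a fixed pairing *)

Section Scale.
Context {R : realType} (k : nat) (s : {perm 'I_(k ^ 2)}).
Implicit Types u : 'I_(k ^ 2) -> R.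

Definition max_load u : R := \big[Num.max/0]_v node_load s u v.

Lemma node_loadZ (c : R) u v : node_load s (fun i => c * u i) v = c * node_load s u v.
Proof. by rewrite /node_load mulr_sumr. Qed.

Lemma max_load_ge0 u : 0 <= max_load u.
Proof. exact: bigmax_ge_id. Qed.

(* Holds without any assumption on [u]: if no node has positive load, then the
   feasible set is unbounded above, so its [sup] is the junk value [0], which is
   also the value of [9^-1 / 0]. *)
Lemma max_scaleE u : max_scale s u = 9^-1 / max_load u.
Proof.
have [M0|] := ltP 0 (max_load u); last first.
  move=> Mle0; have M0 : max_load u = 0 by apply: le_anti; rewrite Mle0 max_load_ge0.
  rewrite M0 invr0 mulr0 /max_scale sup_out // => -[_ [b hb]].
  have : feasible s (fun i => (`|b| + 1) * u i).
    move=> v; rewrite node_loadZ (@le_trans _ _ 0) ?invr_ge0 //.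
    by rewrite mulr_ge0_le0 ?addr_ge0 // -M0 le_bigmax.
  by move/hb => /=; have := ler_norm b; lra.
have e0 : 0 <= 9^-1 / max_load u by rewrite divr_ge0 // ltW.
have feasM : feasible s (fun i => 9^-1 / max_load u * u i).
  move=> v; rewrite node_loadZ -[leRHS](divfK (lt0r_neq0 M0)).
  by rewrite ler_wpM2l // le_bigmax.
have ubM : ubound [set eta | feasible s (fun i => eta * u i)] (9^-1 / max_load u).
  move=> eta feta; have [/le_trans->//|eta0] := leP eta 0.
  rewrite ler_pdivlMr // mulrC -ler_pdivlMr //; apply/bigmax_leP; split=> [|v _].
    by rewrite divr_ge0 // ltW.
  by rewrite ler_pdivlMr // mulrC -node_loadZ.
apply: le_anti; rewrite ge_sup //=; last by exists (9^-1 / max_load u).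
by rewrite ub_le_sup //; exists (9^-1 / max_load u).
Qed.

Lemma throughputE u : throughput s u = 9^-1 / max_load u * \sum_i u i.
Proof. by rewrite /throughput /rate max_scaleE -mulr_sumr. Qed.

Lemma max_load1_le : max_load (fun=> 1) <= (2 * k)%:R.
Proof.
apply/bigmax_leP; split=> [|v _]; first exact: ler0n.
rewrite /node_load sumr_const ler_nat -[X in (X <= _)%N]cardsE.
exact: card_transmits.
Qed.

Lemma max_load_le u : (forall i, 0 <= u i) ->
  max_load u <= \big[Num.max/0]_i u i * max_load (fun=> 1).
Proof.
move=> u0; apply/bigmax_leP; split=> [|v _].
  by rewrite mulr_ge0 // bigmax_ge_id.
apply: (@le_trans _ _ (\big[Num.max/0]_i u i * node_load s (fun=> 1) v)).
  by rewrite /node_load mulr_sumr; apply: ler_sum => i _; rewrite mulr1 le_bigmax.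
by rewrite ler_wpM2l ?bigmax_ge_id // le_bigmax.
Qed.

Definition mean_max_ratio u : R :=
  (\sum_i u i) / ((k ^ 2)%:R * \big[Num.max/0]_i u i).

Lemma mean_max_ratioZ (c : R) u : 0 < c ->
  mean_max_ratio (fun i => c * u i) = mean_max_ratio u.
Proof.
move=> c0; rewrite /mean_max_ratio -mulr_sumr.
have -> : \big[Num.max/0]_i (c * u i) = c * \big[Num.max/0]_i u i.
  apply: (big_ind2 (fun x y => x = c * y)) => [|_ x _ y -> ->|//].
    by rewrite mulr0.
  by rewrite maxr_pMr // ltW.
by rewrite mulrCA -mulf_div divff ?mul1r // lt0r_neq0.
Qed.

Hypothesis k0 : (0 < k)%N.
Hypothesis sP : s \in pairings k.

(** A pairing has no fixed point, so node [i] transmits for its own session. *)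
Lemma le_max_load u i : (forall i, 0 <= u i) -> u i <= max_load u.
Proof.
move=> u0; apply: le_trans (le_bigmax _ _ i).
move: sP; rewrite inE => /forallP sP'.
by rewrite /node_load (bigD1 i) ?transmits_source //= lerDl sumr_ge0.
Qed.

Let i0 : 'I_(k ^ 2).
Proof. by exists 0%N; rewrite expn_gt0 k0. Qed.

Lemma max_load_gt0 u : (forall i, 0 < u i) -> 0 < max_load u.
Proof.
by move=> u0; apply: lt_le_trans (u0 i0) (le_max_load _ _) => i; exact: ltW.
Qed.

(** The rates are a positive multiple of the demands, and the factor cancels. Hence the two lower
    bounds on the throughput coincide. *)
Lemma mean_max_ratio_rate u : (forall i, 0 < u i) ->
  mean_max_ratio (rate s u) = mean_max_ratio u.
Proof.
by move=> u0; rewrite mean_max_ratioZ // max_scaleE divr_gt0 // max_load_gt0.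
Qed.

Lemma throughput1_ge : k%:R / 18 <= throughput s (fun=> 1 : R).
Proof.
have M0 : 0 < max_load (fun=> 1) by exact: max_load_gt0.
rewrite throughputE sumr_const card_ord mulrAC ler_pdivlMr //.
have k0' : 0 <= k%:R / 18 :> R by [].
(* With the load replaced by its bound [2 * k], it remains to see that [k / 18 * (2 * k)] is
   [k ^ 2 / 9]. *)
apply: le_trans (ler_wpM2l k0' max_load1_le) _.
by rewrite natrM natrX; nra.
Qed.

(** No demand exceeds the largest load, so no session gets a rate above [9^-1]. *)
Lemma throughput_le u : (forall i, 0 < u i) -> throughput s u <= (k ^ 2)%:R / 9.
Proof.
move=> u0; have M0 := max_load_gt0 u0.
rewrite throughputE mulrAC ler_pdivrMr // mulrAC [leRHS]mulrC ler_wpM2l //.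
rewrite mulr_natl -[X in _ *+ X]card_ord -sumr_const.
by apply: ler_sum => i _; apply: le_max_load => j; exact: ltW.
Qed.

Lemma throughput_ge u : (forall i, 0 < u i) ->
  0 <= throughput s (fun=> 1) * mean_max_ratio u <= throughput s u.
Proof.
move=> u0; have M0 := max_load_gt0 u0.
have M10 : 0 < max_load (fun=> 1) by exact: max_load_gt0.
have u0' i : 0 <= u i by exact: ltW.
have m0 : 0 < \big[Num.max/0]_i u i by exact: lt_le_trans (u0 i0) (le_bigmax _ _ _).
have S0 : 0 <= \sum_i u i by apply: sumr_ge0.
have n0 : (k ^ 2)%:R != 0 :> R by rewrite pnatr_eq0 -lt0n expn_gt0 k0.
(* Once [k ^ 2] cancels, both sides have the shape [9^-1 / M * \sum_i u i], and [max_load_le]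
   compares the denominators. *)
have -> : throughput s (fun=> 1) * mean_max_ratio u =
    9^-1 / (\big[Num.max/0]_i u i * max_load (fun=> 1)) * \sum_i u i.
  have nE : \sum_(i < k ^ 2) 1 = (k ^ 2)%:R :> R by rewrite sumr_const card_ord.
  rewrite throughputE nE /mean_max_ratio.
  by move: n0; generalize ((k ^ 2)%:R : R) => n n0; field; rewrite n0 !lt0r_neq0.
rewrite mulr_ge0 // ?divr_ge0 ?mulr_ge0 ?(ltW m0) ?(ltW M10) //= throughputE.
by rewrite ler_wpM2r // ler_wpM2l // lef_pV2 ?posrE ?mulr_gt0 // max_load_le.
Qed.

(** The sum is at least [k ^ 2], while the maximum is at most [x]. *)
Lemma mean_max_ratio_ge (x : R) u : (forall i, 1 <= u i <= x) ->
  x^-1 <= mean_max_ratio u.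
Proof.
move=> u1; have [x0 m0] : 0 < x /\ 0 < \big[Num.max/0]_i u i.
  have /andP[u1i uxi] := u1 i0; have u0 : 0 < u i0 by exact: lt_le_trans u1i.
  by split; [exact: lt_le_trans uxi|exact: lt_le_trans u0 (le_bigmax _ _ _)].
have n0 : 0 < (k ^ 2)%:R :> R by rewrite ltr0n expn_gt0 k0.
rewrite /mean_max_ratio ler_pdivlMr ?mulr_gt0 // mulrCA.
apply: (@le_trans _ _ (k ^ 2)%:R).
  rewrite ler_piMr ?(ltW n0) // ler_pdivrMl // mulr1.
  by apply/bigmax_leP; split=> [|i _]; [exact: ltW|case/andP: (u1 i)].
rewrite -[X in X%:R <= _]card_ord -sumr_const.
by apply: ler_sum => i _; case/andP: (u1 i).
Qed.

End Scale.

(** * Measurability of the throughput and of the ratio *)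

Section Measurability.
Context {R : realType} {d : measure_display} {Omega : measurableType d}.

(** A preimage splits into finitely many pieces, one per value of [Y]. With [Y] the random pairing,
    this reduces measurability to a fixed pairing. *)
Lemma measurable_fun_finite_index (T : finType) (Y : Omega -> T) (f : T -> Omega -> R) :
  (forall t, measurable (Y @^-1` [set t])) ->
  (forall t, measurable_fun [set: Omega] (f t)) ->
  measurable_fun [set: Omega] (fun w => f (Y w) w).
Proof.
move=> mY mf _ B mB; rewrite setTI.
rewrite [X in measurable X](_ : _ = \bigcup_t (Y @^-1` [set t] `&` f t @^-1` B)).
  apply: fin_bigcup_measurable => // t _; apply: measurableI => //.
  by rewrite -[X in measurable X]setTI; exact: mf.
by apply/seteqP; split=> w /=; [move=> Bw; exists (Y w)|move=> [t _ [<-]]].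
Qed.

Lemma measurable_bigmax (I : finType) (f : I -> Omega -> R) :
  (forall i, measurable_fun [set: Omega] (f i)) ->
  measurable_fun [set: Omega] (fun w => \big[Num.max/0]_i f i w).
Proof.
move=> mf; elim: (index_enum I) => [|i s IH].
  by under eq_fun do rewrite big_nil; exact: measurable_cst.
by under eq_fun do rewrite big_cons; exact: measurable_maxr.
Qed.

(* Restricted to nonnegative functions, for which inversion is [powR _ (-1)]. *)
Lemma measurable_invr_ge0 (f : Omega -> R) : (forall w, 0 <= f w) ->
  measurable_fun [set: Omega] f -> measurable_fun [set: Omega] (fun w => (f w)^-1).
Proof.
move=> f0 mf; under eq_fun => w do rewrite -powR_inv1 //.
by apply: (measurableT_comp (@measurable_powR R (-1)) mf).
Qed.

Lemma measurable_mean_max_ratio k (f : 'I_(k ^ 2) -> Omega -> R) :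
  (forall i, measurable_fun [set: Omega] (f i)) ->
  measurable_fun [set: Omega] (fun w => mean_max_ratio (f ^~ w)).
Proof.
move=> mf; apply: measurable_funM; first exact: measurable_sum.
apply: measurable_invr_ge0 => [w|]; first by rewrite mulr_ge0 // bigmax_ge_id.
by apply: measurable_funM => //; exact: measurable_bigmax.
Qed.

(** The closed form [max_scaleE] turns the supremum over all real factors into the inverse of a
    finite maximum of sums. *)
Lemma measurable_max_scale k (s : {perm 'I_(k ^ 2)}) (f : 'I_(k ^ 2) -> Omega -> R) :
  (forall i, measurable_fun [set: Omega] (f i)) ->
  measurable_fun [set: Omega] (fun w => max_scale s (f ^~ w)).
Proof.
move=> mf; under eq_fun do rewrite max_scaleE.
apply: measurable_funM => //; apply: measurable_invr_ge0 => [w|].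
  exact: max_load_ge0.
apply: measurable_bigmax => v.
rewrite [X in measurable_fun _ X](_ : _ = fun w => \sum_i
    if transmits (coord v) (coord i) (coord (s i)) then f i w else 0).
  by apply: measurable_sum => i; case: (transmits _ _ _).
by apply/funext => w; rewrite /node_load big_mkcond.
Qed.

Lemma measurable_throughput k (s : {perm 'I_(k ^ 2)}) (f : 'I_(k ^ 2) -> Omega -> R) :
  (forall i, measurable_fun [set: Omega] (f i)) ->
  measurable_fun [set: Omega] (fun w => throughput s (f ^~ w)).
Proof.
move=> mf; apply: measurable_sum => i; apply: measurable_funM => //.
exact: measurable_max_scale.
Qed.

End Measurability.

(** * Expectations and almost sure comparisons *)

Section Expectation.
Context {R : realType} {d : measure_display} {Omega : measurableType d}.
Variable P : probability Omega R.

Lemma ae_expectation_eq (f g : Omega -> R) :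
  measurable_fun [set: Omega] f -> measurable_fun [set: Omega] g ->
  {ae P, forall w, f w = g w} -> ('E_P[f] = 'E_P[g])%E.
Proof.
move=> mf mg fg; rewrite unlock; apply: ae_eq_integral => //.
- exact/measurable_EFinP.
- exact/measurable_EFinP.
- by apply: filterS fg => w /= -> _.
Qed.

(** The bound [c] keeps both expectations finite; [fine] sends an infinite one to 0, which would
    break monotonicity. *)
Lemma ae_fine_expectation_le (c : R) (f g : Omega -> R) :
  measurable_fun [set: Omega] f -> measurable_fun [set: Omega] g ->
  {ae P, forall w, 0 <= f w <= g w /\ g w <= c} ->
  0 <= fine 'E_P[f] <= fine 'E_P[g].
Proof.
(* Truncation at 0 makes both functions nonnegative everywhere and alters them only on a null
   set. *)
move=> mf mg fg; pose f0 w := Num.max (f w) 0; pose g0 w := Num.max (g w) 0.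
have mf0 : measurable_fun [set: Omega] f0 by exact: measurable_maxr.
have mg0 : measurable_fun [set: Omega] g0 by exact: measurable_maxr.
have -> : ('E_P[f] = 'E_P[f0])%E.
  apply: ae_expectation_eq => //; apply: filterS fg => w [/andP[f0w _] _].
  by rewrite /f0 max_l.
have -> : ('E_P[g] = 'E_P[g0])%E.
  apply: ae_expectation_eq => //; apply: filterS fg => w [/andP[f0w fgw] _].
  by rewrite /g0 max_l // (le_trans f0w).
have f00 w : 0 <= f0 w by rewrite le_max lexx orbT.
have g00 w : 0 <= g0 w by rewrite le_max lexx orbT.
have fg0 : ('E_P[f0] <= 'E_P[g0])%E.
  apply: expectation_le => //; apply: filterS fg => w [/andP[f0w fgw] _].
  by rewrite /f0 /g0 !max_l // (le_trans f0w).
have gc : ('E_P[g0] <= (Num.max c 0)%:E)%E.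
  rewrite -(expectation_cst P); apply: expectation_le => // [w|].
    by rewrite le_max lexx orbT.
  apply: filterS fg => w [/andP[f0w fgw] gcw].
  by rewrite /g0 ge_max !le_max gcw lexx orbT.
have Ef0 : (0 <= 'E_P[f0])%E by exact: expectation_ge0.
rewrite fine_ge0 //= fine_le // ge0_fin_numE //.
- by apply: le_lt_trans fg0 (le_lt_trans gc (ltry _)).
- by apply: le_lt_trans gc (ltry _).
- exact: le_trans fg0.
Qed.

Lemma ae_eq1 (A : set Omega) : measurable A -> P A = 1%E -> {ae P, forall w, A w}.
Proof.
move=> mA PA; exists (~` A); split=> //; first exact: measurableC.
by have -> := probability_setC P mA; rewrite PA subee.
Qed.

Lemma ae_uniform_on (T : finType) (D : {set T}) (Y : Omega -> T) :
  uniform_on P D Y -> {ae P, forall w, Y w \in D}.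
Proof.
move=> YD.
(* Each value outside [D] has probability 0, and [T] is finite, so all of them are avoided at
   once. *)
have : {ae P, forall w, forall t : T, t \notin D -> Y w <> t}.
  apply: filter_forall => t; have [mYt PYt] := YD t.
  have [tD|tD] := boolP (t \in D); first by apply: aeW.
  have : {ae P, forall w, (~` (Y @^-1` [set t])) w}.
    apply: ae_eq1; first exact: measurableC.
    by rewrite probability_setC // PYt (negbTE tD) sube0.
  by apply: filterS => w /= Yt _.
by apply: filterS => w /(_ (Y w)); case: (Y w \in D) => // /(_ isT).
Qed.

End Expectation.

(** * Tail estimates for Pareto variables *)

Section Pareto.
Context {R : realType} {d : measure_display} {Omega : measurableType d}.
Variable P : probability Omega R.

Lemma fine_expectationZ_indic (c : R) (A : set Omega) : 0 <= c -> measurable A ->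
  fine 'E_P[fun w => c * \1_A w] = c * fine (P A).
Proof.
move=> c0 mA; have PA : P A \is a fin_num by exact: fin_num_measure.
rewrite -[RHS]/(fine (c * fine (P A))%:E) EFinM fineK // -(expectation_indic P mA) unlock.
rewrite -ge0_integralZl_EFin //=.
  exact/measurable_EFinP.
Qed.

(** Union bound on the complements, each of probability [e]. *)
Lemma prob_bigcap_ge (A : nat -> set Omega) (e : R) n :
  (forall i, measurable (A i)) -> (forall i, P (A i) = (1 - e)%:E) ->
  1 - n%:R * e <= fine (P (\bigcap_(i < n) A i)).
Proof.
move=> mA PA; have mI : measurable (\bigcap_(i < n) A i).
  by apply: bigcap_measurableType => i _.
have PC i : P (~` A i) = e%:E.
  by rewrite probability_setC // PA -EFinB opprB addrC subrK.
have : (P (~` \bigcap_(i < n) A i) <= (n%:R * e)%:E)%E.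
  rewrite setC_bigcap bigcup_mkord.
  apply: (@le_trans _ _ (\sum_(i < n) P (~` A i))%E).
    by apply: (Boole_inequality P (A := fun i => ~` A i)) => i _; exact: measurableC.
  under eq_bigr do rewrite PC.
  by rewrite sumEFin sumr_const card_ord mulr_natl.
have PI : P (\bigcap_(i < n) A i) \is a fin_num by exact: fin_num_measure.
rewrite probability_setC // -(fineK PI) -EFinB lee_fin; lra.
Qed.

Variables (lambda : nat -> {RV P >-> R}) (alpha : R).
Hypothesis lambda_cdf : forall i (x : R), 1 <= x ->
  cdf (lambda i) x = (1 - x `^ (- alpha))%:E.

(** The distribution function vanishes at 1. *)
Lemma pareto_ae_ge1 : {ae P, forall w, forall i, 1 <= lambda i w}.
Proof.
apply: ae_foralln => i.
have : {ae P, forall w, (~` (lambda i @^-1` `]-oo, 1])) w}.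
  have m1 : measurable (lambda i @^-1` `]-oo, 1]).
    by rewrite -[X in measurable X]setTI; exact: measurable_funP.
  apply: ae_eq1; first exact: measurableC.
  have := lambda_cdf i (lexx 1); rewrite /cdf /distribution /pushforward /= => P1.
  by rewrite probability_setC // P1 powR1 subrr sube0.
by apply: filterS => w /=; rewrite in_itv /= => /negP; rewrite -ltNge => /ltW.
Qed.

Lemma pareto_all_le n (x : R) : 1 <= x ->
  1 - n%:R * x `^ (- alpha) <=
    fine (P (\bigcap_(i < n) lambda i @^-1` `]-oo, x])).
Proof.
move=> x1; apply: prob_bigcap_ge => i; last exact: lambda_cdf.
by rewrite -[X in measurable X]setTI; exact: measurable_funP.
Qed.

End Pareto.

(** * The asymptotic bounds on expected throughput *)

Theorem theorem3 (R : realType) (d : measure_display) (Omega : measurableType d)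
    (P : probability Omega R) (lambda : nat -> {RV P >-> R})
    (sigma : forall k : nat, Omega -> {perm 'I_(k ^ 2)})
    (lambda_gt0 : forall i, P [set w | 0 < lambda i w] = 1%E)
    (lambda_indep : mutually_independent lambda)
    (lambda_idd : identically_distributed lambda)
    (sigma_unif : forall k, (2 <= k)%N -> uniform_on P (pairings k) (sigma k))
    (sigma_indep : forall k, (2 <= k)%N -> independent_of_family (sigma k) lambda) :
  let n (k : nat) : R := (k ^ 2)%:R in
  let lam (k : nat) (w : Omega) (i : 'I_(k ^ 2)) : R := lambda i w in
  let r (k : nat) (w : Omega) : 'I_(k ^ 2) -> R := rate (sigma k w) (lam k w) in
  let T1 (k : nat) (w : Omega) : R := throughput (sigma k w) (fun=> 1) in
  let T2 (k : nat) (w : Omega) : R := throughput (sigma k w) (lam k w) in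
  let ratio (k : nat) (u : 'I_(k ^ 2) -> R) : R :=
    (\sum_(i < k ^ 2) u i) / (n k * \big[Num.max/0]_(i < k ^ 2) u i) in
  let E (X : nat -> Omega -> R) : nat -> R^o := fun k => fine ('E_P[X k]) in
  [/\ E T2 =Omega_\oo E (fun k w => T1 k w * ratio k (r k w)),
      E (fun k w => T1 k w * ratio k (r k w))
        =Omega_\oo E (fun k w => T1 k w * ratio k (lam k w))
    & forall alpha : R, 0 < alpha ->
      (forall i (x : R), 1 <= x -> cdf (lambda i) x = (1 - x `^ (- alpha))%:E) ->
      E T2 =Omega_\oo ((fun k => n k `^ (2^-1 - alpha^-1)) : nat -> R^o)].
Proof.
move=> n lam r T1 T2 ratio E.
(* The almost sure event on which the deterministic bounds for a fixed pairing and positive demands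
   apply. *)
have good k : (2 <= k)%N ->
    {ae P, forall w, sigma k w \in pairings k /\ forall i : nat, 0 < lambda i w}.
  move=> k2; have pos : {ae P, forall w, forall i, 0 < lambda i w}.
    apply: ae_foralln => i; apply: ae_eq1 (lambda_gt0 i).
    have := measurable_funP (lambda i) measurableT `]0, +oo[ (measurable_itv _).
    rewrite setTI; congr measurable; apply/seteqP.
    by split=> w /=; rewrite in_itv /= andbT.
  by move: (ae_uniform_on (sigma_unif _ k2)) pos; apply: filterS2 => w; split.
have msig k (f : {perm 'I_(k ^ 2)} -> Omega -> R) : (2 <= k)%N ->
    (forall s, measurable_fun [set: Omega] (f s)) ->
    measurable_fun [set: Omega] (fun w => f (sigma k w) w).
  by move=> k2; apply: measurable_fun_finite_index => s; case: (sigma_unif _ k2 s).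
have mlam k (i : 'I_(k ^ 2)) : measurable_fun [set: Omega] (lambda i).
  exact: measurable_funP.
have mT2 k : (2 <= k)%N -> measurable_fun [set: Omega] (T2 k).
  move=> k2; apply: (msig k (fun s w => throughput s (lam k w))) => // s.
  by apply: measurable_throughput => i; exact: mlam.
have mT1lam k : (2 <= k)%N ->
    measurable_fun [set: Omega] (fun w => T1 k w * ratio k (lam k w)).
  move=> k2; apply: measurable_funM; first by apply: (msig k (fun s _ => throughput s _)).
  by apply: measurable_mean_max_ratio => i; exact: mlam.
have mT1r k : (2 <= k)%N ->
    measurable_fun [set: Omega] (fun w => T1 k w * ratio k (r k w)).
  move=> k2; apply: measurable_funM; first by apply: (msig k (fun s _ => throughput s _)).
  apply: (msig k (fun s w => mean_max_ratio (rate s (lam k w)))) => // s.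
  apply: measurable_mean_max_ratio => i; apply: measurable_funM => //.
  by apply: measurable_max_scale => j; exact: mlam.
have Omega_of (f g : nat -> R^o) (c : R) : 0 < c ->
    (forall k, (2 <= k)%N -> 0 <= g k /\ c * g k <= f k) -> f =Omega_\oo g.
  move=> c0 fg; rewrite eqOmegaE qualifE; apply/asboolP; exists c => //.
  exists 2%N => // k /= k2; have [g0 cg] := fg k k2.
  by rewrite !ger0_norm // (le_trans _ cg) // mulr_ge0 // ltW.
split.
- apply: (Omega_of _ _ 1) => // k k2; rewrite mul1r; apply/andP.
  apply: (@ae_fine_expectation_le _ _ _ _ (n k / 9)); [exact: mT1r|exact: mT2|].
  apply: filterS (good k k2) => w [sP l0]; have k0 : (0 < k)%N by exact: ltnW.
  have -> : ratio k (r k w) = ratio k (lam k w).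
    by apply: mean_max_ratio_rate => // i; exact: l0.
  split; first by apply: throughput_ge => // i; exact: l0.
  by apply: throughput_le => // i; exact: l0.
- apply: (Omega_of _ _ 1) => // k k2; rewrite mul1r; apply/andP.
  apply: (@ae_fine_expectation_le _ _ _ _ (n k / 9)); [exact: mT1lam|exact: mT1r|].
  apply: filterS (good k k2) => w [sP l0]; have k0 : (0 < k)%N by exact: ltnW.
  have -> : ratio k (r k w) = ratio k (lam k w).
    by apply: mean_max_ratio_rate => // i; exact: l0.
  have /andP[T0 T12] : 0 <= T1 k w * ratio k (lam k w) <= T2 k w.
    by apply: throughput_ge => // i; exact: l0.
  rewrite T0 lexx; split=> //; apply: le_trans T12 _.
  by apply: throughput_le => // i; exact: l0.
move=> alpha alpha0 lambda_cdf.
(* The 36 is the 18 of [throughput1_ge] times 2 for the probability [1/2]; the power of 2 comes from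
   [x^-1] below. *)
apply: (Omega_of _ _ (2 `^ (- alpha^-1) / 36)) => [|k k2].
  by rewrite divr_gt0 // powR_gt0.
have k0 : (0 < k)%N by exact: ltnW.
have n0 : 0 < n k by rewrite ltr0n expn_gt0 k0.
split; first exact: powR_ge0.
(* Chosen so that [n k * x ^ (- alpha)] is [1/2], the failure probability in the union bound. *)
pose x := (2 * n k) `^ alpha^-1.
have x1 : 1 <= x.
  apply: (@le_trans _ _ (1 `^ alpha^-1)); first by rewrite powR1.
  rewrite ge0_ler_powR ?nnegrE ?invr_ge0 ?(ltW alpha0) //.
    by rewrite mulr_ge0 // ltW.
  by rewrite -natrM ler1n muln_gt0 expn_gt0 k0.
pose A := \bigcap_(i < k ^ 2) lambda i @^-1` `]-oo, x].
have mA : measurable A.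
  apply: bigcap_measurableType => i _.
  by rewrite -[X in measurable X]setTI; exact: measurable_funP.
have PA : 2^-1 <= fine (P A).
  apply: le_trans (pareto_all_le lambda_cdf (k ^ 2) x1).
  rewrite /x -powRrM mulrN mulVf ?lt0r_neq0 // powR_inv1; last by rewrite mulr_ge0 // ltW.
  rewrite -/(n k) invfM mulrCA divff ?lt0r_neq0 //; lra.
pose c := k%:R / 18 / x.
have c0 : 0 <= c by rewrite !divr_ge0 // (le_trans _ x1).
(* Almost surely [T2] dominates [c * \1_A]: on [A] by the bounds on [T1] and on the ratio, off [A]
   because [T2] is nonnegative. *)
have /andP[_] : 0 <= fine 'E_P[fun w => c * \1_A w] <= E T2 k.
  apply: (@ae_fine_expectation_le _ _ _ _ (n k / 9)); [|exact: mT2|].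
    exact: measurable_funM.
  move: (good k k2) (pareto_ae_ge1 lambda_cdf); apply: filterS2 => w [sP l0] l1.
  have lamP i : 0 < lam k w i by exact: l0.
  split; last exact: throughput_le.
  have /andP[T0 T12] := throughput_ge k0 sP lamP.
  rewrite mulr_ge0 //= indicE; have [|_] := boolP (w \in A); last first.
    by rewrite mulr0 (le_trans T0).
  rewrite inE mulr1 => Aw; apply: le_trans T12.
  rewrite ler_pM ?invr_ge0 ?(le_trans _ x1) // ?throughput1_ge //.
  apply: mean_max_ratio_ge => // i; rewrite l1 /=.
  by have := Aw i (ltn_ord i); rewrite /= in_itv.
rewrite fine_expectationZ_indic // => /(le_trans _); apply.
apply: (@le_trans _ _ (c * 2^-1)); last by rewrite ler_wpM2l.
(* The powers of [n k] are separated so that its square root can be identified with [k]. *)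
rewrite /c /x -powRN powRM ?(ltW n0) // powRD; last by rewrite lt0r_neq0 ?implybT.
have -> : n k `^ 2^-1 = k%:R by rewrite powR12_sqrt ?(ltW n0) // /n natrX sqrtr_sqr ger0_norm.
lra.
Qed.
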